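(* Let $v^i=x^i+z^i$, $i\in\mathbb{N}$, where $\{x^i\}_{i\in\mathbb{N}}$ and $\{z^i\}_{i\in\mathbb{N}}$ are each i.i.d. zero mean Gaussian random variables and $\{z^i\}_{i\in\mathbb{N}}$ is independent of $\{x^i\}_{i\in\mathbb{N}}$. Let $R>0$ and $Q\ge0$ be real numbers, let $\mu_N=\frac1N\sum_{k=1}^N x^k$, and let $$J(\underline\gamma)=\limsup_{N\to\infty}\frac1N\mathbb{E}^{\underline\gamma}\Big[\sum_{i=1}^N R(u^i)^2+Q(u^i-x^i-\mu_N)^2\Big].$$ Let $(\gamma_N^{1*},\dots,\gamma_N^{N*})$ be an optimal solution for the corresponding $N$-decision-maker problem $(\mathcal{P}_N)$. Then the limits $\gamma_\infty^{i*}(v^i)=\lim_{N\to\infty}\gamma_N^{i*}(v^i)$ are achieved and the policy $(\gamma_\infty^{1*},\gamma_\infty^{2*},\dots)$ is globally optimal for $(\mathcal{P}_\infty)$.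
   Context: Static team: for each $i\in\mathbb{N}$ decision maker $i$ observes only the real random variable $v^i$ and applies the real action $u^i=\gamma^i(v^i)$, with $\gamma^i$ an arbitrary measurable function (the set of these is $\Gamma^i$). $\mathbb{E}^{\underline\gamma}$ means that $u^i=\gamma^i(v^i)$ is substituted for all $i$. $(\mathcal{P}_N)$: minimize $J_N(\underline\gamma_N)=\frac1N\mathbb{E}^{\underline\gamma_N}\big[\sum_{i=1}^N R(u^i)^2+Q(u^i-x^i-\mu_N)^2\big]$ over $\underline\gamma_N\in\prod_{i=1}^N\Gamma^i$; optimal means attaining the infimum. $(\mathcal{P}_\infty)$: minimize $J(\underline\gamma)$ over $\underline\gamma\in\prod_{i\in\mathbb{N}}\Gamma^i$; globally optimal means attaining the infimum. In the cost, the sum over $i$ runs over both terms. Limits of policies are understood $\mathbb{P}$-almost surely. *)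

(* Defs.v *)
From HB Require Import structures.
From mathcomp Require Export all_boot all_order all_algebra.
From mathcomp Require Export all_classical all_reals all_analysis.

Set Implicit Arguments.
Unset Strict Implicit.
Unset Printing Implicit Defensive.

Export Order.TTheory GRing.Theory Num.Theory.
Export numFieldNormedType.Exports.

Local Open Scope classical_set_scope.
Local Open Scope ring_scope.

(* The scalars are K : realType, since R and Q are the weights of the cost
   (written r and q).  Decision makers are numbered from 0, so that the first N
   of them are indexed by 'I_N. *)

Section Laws.
Context d (Omega : measurableType d) (K : realType) (P : probability Omega K).

Definition mutually_independent (X : nat -> {RV P >-> K}) : Prop :=
  forall (s : seq nat) (A : nat -> set K), uniq s ->
    (forall i, measurable (A i)) ->
    P (\bigcap_(i in [set` s]) (X i @^-1` A i)) =
    (\prod_(i <- s) P (X i @^-1` A i))%E.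

Definition sigma_generated (X : nat -> {RV P >-> K}) : set (set Omega) :=
  <<s \bigcup_i preimage_set_system setT (X i) measurable >>.

Definition independent_families (X Y : nat -> {RV P >-> K}) : Prop :=
  forall A B, sigma_generated X A -> sigma_generated Y B ->
    P (A `&` B) = (P A * P B)%E.

Definition identically_distributed (X : nat -> {RV P >-> K}) : Prop :=
  forall i j (A : set K), measurable A ->
    distribution P (X i) A = distribution P (X j) A.

(* s is the standard deviation.  Constants count as (degenerate) Gaussians; the
   case s = 0 is separate because normal_prob m 0 is uniform on [0, 1]. *)
Definition gaussian_law (m s : K) (A : set K) : \bar K :=
  if s == 0 then \d_m A else normal_prob m s A.

Definition zero_mean_gaussian (X : {RV P >-> K}) : Prop :=
  exists s : K, 0 <= s /\
    forall A : set K, measurable A -> distribution P X A = gaussian_law 0 s A.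

Definition iid_zero_mean_gaussian (X : nat -> {RV P >-> K}) : Prop :=
  [/\ mutually_independent X, identically_distributed X &
      forall i, zero_mean_gaussian (X i)].

End Laws.

Section Team.
Context d (Omega : measurableType d) (K : realType) (P : probability Omega K).

(* Policies of the decision makers in I: the product over I of the sets of
   measurable maps from observations to actions. *)
Definition policies (I : Type) : set (I -> K -> K) :=
  [set g | forall i, measurable_fun setT (g i)].

Definition empirical_mean (x : nat -> {RV P >-> K}) (N : nat) (w : Omega) : K :=
  N%:R^-1 * \sum_(k < N) x k w.

(* The expectation of a nonnegative function: +oo is a possible value. *)
Definition team_cost (r q : K) (x v : nat -> {RV P >-> K}) (N : nat)
    (g : 'I_N -> K -> K) : \bar K :=
  ((N%:R^-1)%:E *
   'E_P[fun w => (\sum_(i < N)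
      (r * g i (v i w) ^+ 2 +
       q * (g i (v i w) - x i w - empirical_mean x N w) ^+ 2))%R])%E.

Definition limit_cost (r q : K) (x v : nat -> {RV P >-> K})
    (g : nat -> K -> K) : \bar K :=
  limn_esup (fun N => team_cost r q x v (fun i : 'I_N => g i)).

Definition minimizes (I : Type) (J : (I -> K -> K) -> \bar K)
    (g : I -> K -> K) : Prop :=
  policies g /\ J g = ereal_inf (J @` @policies I).

(* lshift n ord_max : 'I_(i.+1 + n) has value i, so this is the policy of
   decision maker i in the team of i.+1 + n members; smaller teams do not
   contain i. *)
Definition policy_of (g : forall N, 'I_N -> K -> K) (i n : nat) : K -> K :=
  g (i.+1 + n)%N (lshift n (ord_max : 'I_i.+1)).

Definition as_limit_policy (v : nat -> {RV P >-> K})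
    (g : forall N, 'I_N -> K -> K) (ginf : nat -> K -> K) : Prop :=
  forall i, {ae P, forall w,
    policy_of g i n (v i w) @[n --> \oo] --> ginf i (v i w)}.

End Team.

(* Main.v *)
Require Import Defs.
From HB Require Import structures.
From mathcomp Require Import measurable_realfun ring lra.

(** The cost couples the decision makers through [mu_N] alone, and [mu_N] does
not depend on the actions.  An optimal policy of the team of [N] members thus
solves [N] separate least-squares problems, in which decision maker [i] tracks
[x i + mu_N] on the basis of [v i].  The first-order condition of the [i]-th
problem is
  [(r + q) E[g_i(v_i) phi(v_i)] = q E[(x_i + mu_N) phi(v_i)]]
for all square integrable [phi(v_i)] ([minimizer_orthogonal]).  When [k] differs
from [i], the centered variable [x_k] is independent of [v_i] and contributes
nothing, so the right-hand side equals [q (1 + 1/N) E[x_i phi(v_i)]]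
([minimizer_normal_equation]).  It depends on [N] only through the factor
[1 + 1/N], whence optimal policies of teams of sizes [N] and [M] are almost
surely proportional with ratio [(1 + 1/N) / (1 + 1/M)]
([minimizers_proportional]).  The almost sure limit therefore exists: it is the
optimal policy of any team that contains [i], divided by that team's factor
([limit_policy]).  This argument never computes [E[x_i | v_i]]: that projection
is read off from the given optimal policies.

For global optimality, the limit policy is [N/(N+1)] times the optimal policy of
the [N]-member team, that is, a convex combination of that policy and of the
zero policy with weights [N/(N+1)] and [1/(N+1)].  The cost is convex
([team_cost_shrink]), and the zero policy costs at most [4 q E[x_0^2]] whatever
[N] ([team_cost_zero_le]).  Against an arbitrary policy [h] this gives
  [J_N(limit) <= J_N(optimum) + O(1/N) <= J_N(h) + O(1/N)],
and the upper limits as [N] grows compare in the same way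
([as_limit_policy_optimal]).

What the proof takes from the laws of the [x_i] is that they are centered and
square integrable, with a common second moment. *)

Set Implicit Arguments.
Unset Strict Implicit.
Unset Printing Implicit Defensive.

Local Open Scope classical_set_scope.
Local Open Scope ring_scope.

(** * The normal law *)

Section NormalLaw.
Context (K : realType).
Local Notation mu := (@lebesgue_measure K).

Lemma normal_prob_opp (s : K) (A : set K) : s != 0 -> measurable A ->
  normal_prob 0 s (-%R @^-1` A) = normal_prob 0 s A.
Proof.
move=> s0 mA; rewrite /normal_prob.
have mpdf (D : set K) : measurable_fun D (EFin \o normal_pdf 0 s).
  by apply/measurable_EFinP/measurable_funTS; exact: measurable_normal_pdf.
transitivity (\int[pushforward mu (-%R : _ -> measurableTypeR K)]_(x in A)
    (normal_pdf 0 s x)%:E)%E.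
  rewrite ge0_integral_pushforward//; [|exact: mpdf|]; last first.
    by move=> x _; rewrite lee_fin normal_pdf_ge0.
  apply: eq_integral => x _ /=; rewrite !normal_pdfE// /= /normal_fun.
  by rewrite !subr0 sqrrN.
apply/esym; apply: eq_measure_integral => //= B mB _.
exact/esym/lebesgue_measureN.
Qed.

(** The density of the normal law is its Radon-Nikodym derivative up to a null
set, which reduces integration against the law to the general change of
variables for absolutely continuous measures. *)
Lemma ge0_integral_normal_prob (s : K) (f : K -> \bar K) :
    (forall x, 0 <= f x)%E -> measurable_fun [set: K] f ->
  (\int[normal_prob 0 s]_x f x = \int[mu]_x (f x * (normal_pdf 0 s x)%:E))%E.
Proof.
move=> f0 mf; have dom := @normal_prob_dominates K 0 s.
rewrite -(Radon_Nikodym_SigmaFinite.change_of_variables dom)//.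
have mpdf : measurable_fun [set: K] (EFin \o normal_pdf 0 s).
  by apply/measurable_EFinP; exact: measurable_normal_pdf.
have iRN := Radon_Nikodym_SigmaFinite.f_integrable dom.
apply: ae_eq_integral => //.
- by apply: emeasurable_funM => //; exact: measurable_int iRN.
- exact: emeasurable_funM.
- apply: ae_eqe_mul2l; apply: integral_ae_eq => // E _ mE.
  by rewrite -Radon_Nikodym_SigmaFinite.f_integral.
Qed.

(** The factor [x^2] is absorbed by doubling the standard deviation: with
[y = 3 x^2 / (8 s^2)] one has
  [exp(- x^2 / (2 s^2)) = exp(- x^2 / (8 s^2)) exp(- y)],
and [y exp(- y) <= 1]. *)
Lemma normal_second_moment_lty (s : K) : s != 0 ->
  (\int[normal_prob 0 s]_x (x ^+ 2)%:E < +oo)%E.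
Proof.
move=> s0; rewrite ge0_integral_normal_prob//; last 2 first.
- by move=> x; rewrite lee_fin sqr_ge0.
- by apply/measurable_EFinP; exact: measurable_funX.
have s20 : 2 * s != 0 by rewrite mulf_neq0.
have s2p : 0 < s ^+ 2 by rewrite exprn_even_gt0.
(* c is x^2 / y, corrected by the ratio of the two normalizing constants *)
pose c : K := 8%:R / 3%:R * s ^+ 2 * normal_peak s / normal_peak (2 * s).
have c0 : 0 <= c.
  apply: divr_ge0 (normal_peak_ge0 _).
  by rewrite mulr_ge0 ?normal_peak_ge0 // mulr_ge0 ?ltW // divr_ge0.
have mpdf t : measurable_fun [set: K] (EFin \o normal_pdf 0 t).
  by apply/measurable_EFinP; exact: measurable_normal_pdf.
apply: (@le_lt_trans _ _ (\int[mu]_x (c%:E * (normal_pdf 0 (2 * s) x)%:E))%E).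
  apply: ge0_le_integral => //.
  - by move=> x _; rewrite mule_ge0// lee_fin ?sqr_ge0 ?normal_pdf_ge0.
  - apply: emeasurable_funM; last exact: mpdf.
    by apply/measurable_EFinP; exact: measurable_funX.
  - by apply: emeasurable_funM; [exact: measurable_cst|exact: mpdf].
  - move=> x _; rewrite -!EFinM lee_fin !normal_pdfE// /=.
    have pk0 : 0 < normal_peak (2 * s) by exact: normal_peak_gt0.
    pose y := 3%:R / 8%:R * (x ^+ 2 / s ^+ 2).
    pose e := x ^+ 2 / (8%:R * s ^+ 2).
    have y0 : 0 <= y by rewrite /y mulr_ge0 ?divr_ge0 ?sqr_ge0.
    have -> : x ^+ 2 * (normal_peak s * normal_fun 0 s x) =
        c * normal_peak (2 * s) * expR (- e) * (y * expR (- y)).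
      rewrite /normal_fun (_ : - (x - 0) ^+ 2 / (s ^+ 2 *+ 2) = - e + - y).
        by rewrite expRD /c /y; field; rewrite s0 gt_eqF.
      by rewrite /e /y; field.
    have -> : c * (normal_peak (2 * s) * normal_fun 0 (2 * s) x) =
        c * normal_peak (2 * s) * expR (- e) * 1.
      rewrite /normal_fun mulr1 mulrA; congr (_ * expR _).
      by rewrite /e; field.
    have cpk : 0 <= c * normal_peak (2 * s) by rewrite mulr_ge0 // ltW.
    apply: ler_wpM2l; first by rewrite mulr_ge0 ?expR_ge0.
    rewrite expRN ler_pdivrMr ?expR_gt0// mul1r.
    by rewrite (le_trans _ (expR_ge1Dx y))// lerDr.
rewrite ge0_integralZl//;
  [|exact: mpdf|by move=> x _; rewrite lee_fin normal_pdf_ge0].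
by rewrite integral_normal_pdf mule1 ltry.
Qed.

End NormalLaw.

(** * Moments *)

Section Moments.
Context d (Omega : measurableType d) (K : realType) (P : probability Omega K).

Lemma Lfun2P (X : Omega -> K) : measurable_fun setT X ->
  ('E_P[X ^+ 2] < +oo)%E -> X \in Lfun P 2%:E.
Proof.
move=> mX; rewrite unlock => X2; rewrite inE; apply/andP; split; rewrite inE//=.
rewrite /finite_norm unlock /Lnorm poweR_lty//.
move: X2; congr (_ < _)%E; apply: eq_integral => w _.
by rewrite /= powR_mulrn// real_normK// num_real.
Qed.

Lemma Lfun_measurable (X : Omega -> K) p : X \in Lfun P p -> measurable_fun setT X.
Proof. by rewrite inE => /andP[]; rewrite inE. Qed.

Lemma Lfun2D (X Y : Omega -> K) : X \in Lfun P 2%:E -> Y \in Lfun P 2%:E ->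
  X + Y \in Lfun P 2%:E.
Proof. by move=> X2 Y2; rewrite rpredD ?lee1n. Qed.

Lemma Lfun2B (X Y : Omega -> K) : X \in Lfun P 2%:E -> Y \in Lfun P 2%:E ->
  X - Y \in Lfun P 2%:E.
Proof. by move=> X2 Y2; rewrite rpredB ?lee1n. Qed.

Lemma Lfun2_scale (X : Omega -> K) (a : K) : X \in Lfun P 2%:E ->
  a \o* X \in Lfun P 2%:E.
Proof. by move=> X2; apply: Lfun_scale; rewrite ?ler1n. Qed.

Lemma second_moment_fin_num (X : Omega -> K) : X \in Lfun P 2%:E ->
  ('E_P[X ^+ 2])%E \is a fin_num.
Proof. by move=> X2; apply: expectation_fin_num; exact: Lfun2_mul_Lfun1. Qed.

Lemma zero_mean_gaussian_Lfun2 (X : {RV P >-> K}) :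
  zero_mean_gaussian X -> (X : Omega -> K) \in Lfun P 2%:E.
Proof.
move=> [s [s0 XE]]; apply: Lfun2P => //; rewrite unlock.
(* Lebesgue measure, hence normal_prob, lives on measurableTypeR K, whose
   measurable sets are those of K but under another display. *)
have mX : measurable_fun [set: Omega] (X : Omega -> measurableTypeR K).
  exact: (@measurable_funPT _ _ _ _ X).
have msqr : measurable_fun [set: measurableTypeR K] (fun y : K => (y ^+ 2)%:E).
  by apply/measurable_EFinP; exact: measurable_funX.
rewrite -[ltLHS](ge0_integral_pushforward mX P measurableT msqr); last first.
  by move=> y _; rewrite lee_fin sqr_ge0.
move: XE; rewrite /gaussian_law; case: eqVneq => [_|sn0] XE.
  rewrite (eq_measure_integral (\d_(0 : measurableTypeR K)))//.
    by rewrite integral_dirac// diracT mul1e expr0n ltry.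
  by move=> A mA _; exact: XE.
rewrite (eq_measure_integral (normal_prob 0 s)).
  exact: normal_second_moment_lty.
by move=> A mA _; exact: XE.
Qed.

(** The law is invariant under negation, so [X] and [- X] have the same mean. *)
Lemma zero_mean_gaussian_mean (X : {RV P >-> K}) :
  zero_mean_gaussian X -> ('E_P[X] = 0)%E.
Proof.
move=> gX; have X2 := zero_mean_gaussian_Lfun2 gX.
have X1 : (X : Omega -> K) \in Lfun P 1.
  by apply: Lfun_subset12 => //; exact: fin_num_measure.
have iX := (Lfun1_integrable P _).1 X1.
have mX : measurable_fun setT (X : Omega -> K) by [].
have mNX : measurable_fun setT (fun w => - X w) by exact: measurableT_comp.
have symm : ('E_P[X] = 'E_P[fun w => (- X w)%R])%E.
  rewrite unlock.
  have mid : measurable_fun [set: K] (EFin : K -> \bar K).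
    exact: EFin_measurable.
  rewrite -[LHS](@integral_pushforward _ _ _ _ _ _ mX P setT _ mid)//.
  rewrite -[RHS](@integral_pushforward _ _ _ _ _ _ mNX P setT _ mid)//; last first.
    by rewrite preimage_setT; have := integrableN iX.
  apply: eq_measure_integral => //= A mA _; move: gX => [s [s0 XE]].
  have mNA : measurable (-%R @^-1` A : set K).
    by rewrite -[X in measurable X]setTI; exact: oppr_measurable.
  rewrite [RHS](_ : _ = distribution P X (-%R @^-1` A))//.
  rewrite [LHS](_ : _ = distribution P X A)// !XE//.
  rewrite /gaussian_law; case: eqVneq => [_|sn0]; last by rewrite normal_prob_opp.
  rewrite !diracE; congr ((_ : bool)%:R%:E).
  by apply/idP/idP; rewrite !inE/= oppr0.
have := expectation_fin_num X1; move: symm.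
have -> : ('E_P[fun w => (- X w)%R] = - 'E_P[X])%E.
  by rewrite unlock -integralN//=; exact: integrable_add_def.
case: ('E_P[X])%E => //= e [/eqP]; rewrite -subr_eq0 opprK -mulr2n mulrn_eq0/=.
by move=> /eqP ->.
Qed.

Lemma identically_distributed_second_moment (X : nat -> {RV P >-> K}) i j :
  identically_distributed X -> ('E_P[X i ^+ 2] = 'E_P[X j ^+ 2])%E.
Proof.
move=> idX; rewrite unlock.
have msq : measurable_fun [set: K] (fun y : K => (y ^+ 2)%:E).
  by apply/measurable_EFinP; exact: measurable_funX.
have sq0 y : (0 <= (y ^+ 2)%:E :> \bar K)%E by rewrite lee_fin sqr_ge0.
rewrite -[LHS](ge0_integral_distribution (X i) msq sq0).
rewrite -[RHS](ge0_integral_distribution (X j) msq sq0).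
by apply: eq_measure_integral => A mA _; exact: idX.
Qed.

End Moments.

(** * Independence *)

Section Independence.
Context d (Omega : measurableType d) (K : realType) (P : probability Omega K).

Definition independent (X Y : Omega -> K) : Prop :=
  forall A B : set K, measurable A -> measurable B ->
    P (X @^-1` A `&` Y @^-1` B) = (P (X @^-1` A) * P (Y @^-1` B))%E.

Lemma measurable_preim (X : Omega -> K) (A : set K) :
  measurable_fun setT X -> measurable A -> measurable (X @^-1` A).
Proof. by move=> mX mA; rewrite -[X in measurable X]setTI; exact: mX. Qed.

Lemma independent_comp (X Y : Omega -> K) (g : K -> K) :
  measurable_fun setT g -> independent X Y -> independent X (g \o Y).
Proof.
move=> mg XY A B mA mB; rewrite comp_preimage XY//.
by rewrite -[X in measurable X]setTI; exact: mg.
Qed.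

(** Independence says that the law of [(X, Y)] is the product of the two laws,
and Fubini's theorem integrates [X] out first. *)
Lemma expectation_mul_independent (X Y : Omega -> K) :
    X \in Lfun P 2%:E -> Y \in Lfun P 2%:E -> independent X Y ->
  ('E_P[X] = 0)%E -> ('E_P[X \* Y] = 0)%E.
Proof.
move=> X2 Y2 XY EX0.
have mX := Lfun_measurable X2; have mY := Lfun_measurable Y2.
pose Xm : {mfun Omega >-> K} := HB.pack X (isMeasurableFun.Build _ _ _ _ X mX).
pose Ym : {mfun Omega >-> K} := HB.pack Y (isMeasurableFun.Build _ _ _ _ Y mY).
have mZ : measurable_fun setT (fun w => (X w, Y w)).
  exact: measurable_fun_pair.
pose Zm : {mfun Omega >-> (K * K)%type} :=
  HB.pack (fun w => (X w, Y w))
    (isMeasurableFun.Build _ _ _ _ (fun w => (X w, Y w)) mZ).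
pose f (p : K * K) : \bar K := (p.1 * p.2)%:E.
have mf : measurable_fun setT f.
  by apply/measurable_EFinP; apply: measurable_funM.
have X1 : P.-integrable setT (EFin \o X).
  by apply/Lfun1_integrable; apply: Lfun_subset12 => //; exact: fin_num_measure.
have XY1 : P.-integrable setT (f \o Zm).
  by apply/(Lfun1_integrable _ (X \* Y)); exact: Lfun2_mul_Lfun1.
have prodE A : measurable A ->
    (distribution P Xm \x distribution P Ym)%E A = distribution P Zm A.
  by apply: product_measure_unique => B C mB mC; exact: XY.
have fint : (distribution P Xm \x distribution P Ym)%E.-integrable setT f.
  have /integrableP[_ fZ] : (distribution P Zm).-integrable setT f.
    exact: integrable_pushforward.
  apply/integrableP; split => //.
  by rewrite (eq_measure_integral (distribution P Zm))// => A mA _; exact: prodE.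
transitivity (\int[distribution P Zm]_p f p)%E.
  by rewrite integral_distribution// unlock.
rewrite (eq_measure_integral (distribution P Xm \x distribution P Ym)%E); last first.
  by move=> A mA _; exact/esym/prodE.
rewrite -integral21_prod_meas1//.
rewrite [LHS]integral0_eq// => y _; rewrite /fubini_G /f /=.
have mid : measurable_fun [set: K] (EFin : K -> \bar K) by exact: EFin_measurable.
under eq_integral do rewrite EFinM.
rewrite integralZr//; last exact: integrable_pushforward.
rewrite (_ : (\int[_]_x _)%E = 0%E) ?mul0e//.
by rewrite integral_distribution// -EX0 unlock.
Qed.

(** Rectangles are stable under intersection and generate the product
sigma-algebra, and the sets [D] satisfying the product rule form a Dynkin
system. *)
Lemma independent_event_pair (F : set Omega) (X Z : Omega -> K) :
    measurable F -> measurable_fun setT X -> measurable_fun setT Z ->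
    (forall A B : set K, measurable A -> measurable B ->
      P (F `&` (X @^-1` A `&` Z @^-1` B)) =
      (P F * P (X @^-1` A `&` Z @^-1` B))%E) ->
  forall D : set (K * K), measurable D ->
    P (F `&` (fun w => (X w, Z w)) @^-1` D) =
    (P F * P ((fun w => (X w, Z w)) @^-1` D))%E.
Proof.
move=> mF mX mZ FXZ D mD; set W := fun w => (X w, Z w).
have mW : measurable_fun setT W by exact: measurable_fun_pair.
have mWp (S : set (K * K)) : measurable S -> measurable (W @^-1` S).
  by move=> mS; rewrite -[X in measurable X]setTI; exact: mW.
move: mD; rewrite measurable_prod_measurableType; move: D.
apply: dynkin_induction => //=.
- by rewrite measurable_prod_measurableType.
- move=> _ _ [A1 mA1 [A2 mA2 <-]] [B1 mB1 [B2 mB2 <-]].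
  exists (A1 `&` B1); first exact: measurableI.
  by exists (A2 `&` B2); [exact: measurableI|rewrite setXI].
- by rewrite preimage_setT setIT probability_setT mule1.
- by move=> _ [A mA [B mB <-]]; exact: FXZ.
- move=> S mS IS.
  rewrite preimage_setC -setDE measureD//; [|exact: mWp|].
    rewrite [X in (_ - X)%E]IS probability_setC; last exact: mWp.
    by rewrite muleBr ?mule1// ?fin_num_measure.
  by rewrite -ge0_fin_numE// fin_num_measure.
- move=> S mS /trivIsetP tS IS.
  have tWS : trivIset setT (fun n => W @^-1` S n).
    by apply/trivIsetP => m n _ _ mn; rewrite -preimage_setI tS// preimage_set0.
  have mWS n : measurable (W @^-1` S n) by exact: mWp.
  rewrite preimage_bigcup setI_bigcupr.
  rewrite !measure_bigcup//=; last 2 first.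
  - by move=> n _; exact: measurableI.
  - exact: trivIset_setIl.
  have /fineK pF : P F \is a fin_num by exact: fin_num_measure.
  by rewrite -pF -nneseriesZl// pF; apply: eq_eseriesr => n _.
Qed.

(** Mutual independence of [x] separates [x k] from [x i], and independence of
the two families separates [z i] from both; together [x k] is independent of
the pair [(x i, z i)], of which [v i] is a function. *)
Lemma independent_observation (x z v : nat -> {RV P >-> K}) (k i : nat) :
    mutually_independent x -> independent_families z x ->
    (forall j w, v j w = x j w + z j w) -> k != i ->
  independent (x k) (v i).
Proof.
move=> ix izx vE ki A B mA mB.
have mxA : measurable (x k @^-1` A) by exact: measurable_preim.
have gen (X : nat -> {RV P >-> K}) j C :
    measurable C -> sigma_generated X (X j @^-1` C).
  move=> mC; apply: sub_gen_smallest; exists j => //; exists C => //; exact: setTI.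
have mS : measurable ((fun p : K * K => p.1 + p.2) @^-1` B).
  rewrite -[X in measurable X]setTI.
  have : measurable_fun setT (fun p : K * K => p.1 + p.2).
    exact: measurable_funD.
  exact.
have -> : v i @^-1` B =
    (fun w => (x i w, z i w)) @^-1` ((fun p : K * K => p.1 + p.2) @^-1` B).
  by apply/seteqP; split => w /=; rewrite vE.
apply: independent_event_pair => // C D mC mD.
have xkxi : P (x k @^-1` A `&` x i @^-1` C) =
    (P (x k @^-1` A) * P (x i @^-1` C))%E.
  pose E j := if j == k then A else C.
  have mE j : measurable (E j) by rewrite /E; case: ifP.
  have := ix [:: k; i] E _ mE; rewrite /= inE ki => /(_ isT).
  rewrite !big_cons big_nil mule1 {2}/E eqxx {2}/E eq_sym (negbTE ki) => <-.
  congr (P _); apply/seteqP; split => w /=.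
    move=> [wA wC] j; rewrite /= !inE /E => /orP[]/eqP ->;
      by rewrite ?eqxx// eq_sym (negbTE ki).
  move=> H; split.
    by have := H k; rewrite /= /E eqxx; apply; rewrite inE eqxx.
  by have := H i; rewrite /= /E eq_sym (negbTE ki); apply; rewrite !inE eqxx orbT.
have genI : sigma_generated x (x k @^-1` A `&` x i @^-1` C).
  pose G := \bigcup_j preimage_set_system setT (x j) measurable.
  by apply: (@measurableI _ (g_sigma_algebraType G)); exact: gen.
rewrite setIA [X in P X]setIC izx//; last exact: gen.
rewrite xkxi [in RHS]setIC izx; [|exact: gen|exact: gen].
by rewrite muleC muleAC -muleA.
Qed.

End Independence.

(** * Limits superior and quadratic minima *)

Lemma le_limn_esup_vanishing (K : realType) (u w : nat -> \bar K) (e : nat -> K) :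
    (forall n, u n <= w n + (e n)%:E)%E -> e n @[n --> \oo] --> 0 ->
  (limn_esup u <= limn_esup w)%E.
Proof.
move=> uw e0; apply/lee_addgt0Pr => t t0.
rewrite -leeBlDr//; apply: le_ereal_inf_tmp => _ [A [m _ mA] <-].
rewrite leeBlDr//.
have [m' _ small] : \forall n \near \oo, e n < t.
  have := @cvgr_lt _ _ _ _ e 0 e0 t t0; exact.
apply: (@le_trans _ _ (ereal_sup (u @` [set n | (maxn m m' <= n)%N]))).
  apply: ereal_inf_lbound.
  by exists [set n | (maxn m m' <= n)%N] => //; exists (maxn m m').
apply: ge_ereal_sup => _ [n /= mn <-]; move: mn; rewrite geq_max => /andP[mn m'n].
apply: (le_trans (uw n)); apply: leeD.
  by apply: ereal_sup_ubound; exists n => //; exact: mA.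
by rewrite lee_fin ltW//; exact: small.
Qed.

Lemma quadratic_ge0_linear0 (K : realFieldType) (b c : K) :
  0 <= c -> (forall t, 0 <= t * b + t ^+ 2 * c) -> b = 0.
Proof.
move=> c0 H; have c1 : 0 < c + 1 by rewrite ltr_wpDl.
(* The minimizer would be - b / (2 c); this t makes the value negative unless
   b = 0, also when c = 0. *)
have := H (- b / (c + 1)).
have -> : - b / (c + 1) * b + (- b / (c + 1)) ^+ 2 * c =
    - (b ^+ 2 / (c + 1) ^+ 2).
  by field; rewrite gt_eqF.
rewrite oppr_ge0 pmulr_lle0 ?invr_gt0 ?exprn_gt0// => b2.
by apply/eqP; rewrite -sqrf_eq0 eq_le b2 sqr_ge0.
Qed.

(** * The cost of a finite team *)

(** The [N]-member team is seen from its member [i] as an instance of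
[policy_of]; the sizes [N] and [i.+1 + (N - i.+1)] are only propositionally
equal, hence the transport along [e] in the proof. *)
Lemma policy_of_ord (K : realType) (g : forall N, 'I_N -> K -> K) N (i : 'I_N) :
  g N i = policy_of g i (N - i.+1).
Proof.
rewrite /policy_of; move: (subnKC (ltn_ord i)) => NE.
have H M (j : 'I_M) (e : M = N) : j = i :> nat -> g N i = g M j.
  by subst M => ji; congr (g N); exact/val_inj/esym.
exact: H.
Qed.

Section Team.
Context d (Omega : measurableType d) (K : realType) (P : probability Omega K).
Context (r q : K) (x v : nat -> {RV P >-> K}).
Context (hr : 0 < r) (hq : 0 <= q).

Local Notation optimal N := (minimizes (@team_cost _ _ _ P r q x v N)).

Definition realized_cost (N : nat) (g : 'I_N -> K -> K) (w : Omega) : K :=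
  \sum_(i < N) (r * g i (v i w) ^+ 2 +
    q * (g i (v i w) - x i w - empirical_mean x N w) ^+ 2).

Definition zero_policy (N : nat) : 'I_N -> K -> K := fun _ _ => 0.

Lemma policies_zero N : policies (@zero_policy N).
Proof. by move=> i; exact: measurable_cst. Qed.

Lemma measurable_empirical_mean N : measurable_fun setT (empirical_mean x N).
Proof.
by apply: measurable_funM => //; apply: measurable_sum => k.
Qed.

Lemma measurable_realized_cost N (g : 'I_N -> K -> K) :
  policies g -> measurable_fun setT (realized_cost g).
Proof.
move=> mg; apply: measurable_sum => i.
have mgv : measurable_fun setT (fun w => g i (v i w)).
  exact: (measurableT_comp (mg i)).
apply: measurable_funD; apply: measurable_funM => //;
  apply: measurable_funX => //.
apply: measurable_funB; first exact: measurable_funB.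
exact: measurable_empirical_mean.
Qed.

Lemma realized_cost_ge0 N (g : 'I_N -> K -> K) w : 0 <= realized_cost g w.
Proof.
by apply: sumr_ge0 => i _; rewrite addr_ge0// mulr_ge0 ?sqr_ge0// ltW.
Qed.

Lemma expected_cost_ge0 N (g : 'I_N -> K -> K) : (0 <= 'E_P[realized_cost g])%E.
Proof. by apply: expectation_ge0; exact: realized_cost_ge0. Qed.

Lemma le_team_cost N (g h : 'I_N -> K -> K) : (0 < N)%N ->
  (team_cost r q x v g <= team_cost r q x v h)%E =
  ('E_P[realized_cost g] <= 'E_P[realized_cost h])%E.
Proof. by move=> N0; rewrite /team_cost lee_pmul2l// lte_fin invr_gt0 ltr0n. Qed.

Lemma minimizes_le N (g h : 'I_N -> K -> K) : (0 < N)%N ->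
  optimal N g -> policies h ->
  ('E_P[realized_cost g] <= 'E_P[realized_cost h])%E.
Proof.
move=> N0 [_ gmin] mh; rewrite -le_team_cost// gmin.
by apply: ereal_inf_lbound; exists h.
Qed.

(** Convexity of the cost along the segment from the zero policy to [g], with the
weight [a] of [g] rounded up to one.  It holds realization by realization, hence
also when the expected cost of [g] is infinite. *)
Lemma team_cost_shrink N (g h : 'I_N -> K -> K) (a : K) :
    0 <= a <= 1 -> policies g -> policies h ->
    (forall i, {ae P, forall w, h i (v i w) = a * g i (v i w)}) ->
  (team_cost r q x v h <=
   team_cost r q x v g + (1 - a)%:E * team_cost r q x v (@zero_policy N))%E.
Proof.
move=> /andP[a0 a1] mg mh hg.
have b0 : 0 <= 1 - a by rewrite subr_ge0.
have mR := measurable_realized_cost mg.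
have mR0 := measurable_realized_cost (@policies_zero N).
have mRh := measurable_realized_cost mh.
rewrite /team_cost muleCA -ge0_muleDr ?mule_ge0 ?lee_fin ?expected_cost_ge0//.
rewrite lee_wpmul2l ?lee_fin ?invr_ge0//.
rewrite -/(realized_cost h) -/(realized_cost g).
rewrite -/(realized_cost (@zero_policy N)).
rewrite unlock -ge0_integralZl//; last 2 first.
- exact/measurable_EFinP.
- by move=> w _; rewrite lee_fin realized_cost_ge0.
rewrite -ge0_integralD//; last 4 first.
- by move=> w _; rewrite lee_fin realized_cost_ge0.
- exact/measurable_EFinP.
- by move=> w _; rewrite -EFinM lee_fin mulr_ge0// realized_cost_ge0.
- by apply/measurable_EFinP; exact: measurable_funM.
apply: ae_ge0_le_integral => //.
- by move=> w _; rewrite lee_fin realized_cost_ge0.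
- exact/measurable_EFinP.
- move=> w _; rewrite -EFinM -EFinD lee_fin.
  by rewrite addr_ge0 ?mulr_ge0 ?realized_cost_ge0.
- apply/measurable_EFinP; apply: measurable_funD => //.
  exact: measurable_funM.
have : {ae P, forall w, forall i, h i (v i w) = a * g i (v i w)}.
  by apply: filter_forall.
apply: filterS => w hgw _; rewrite -EFinM -EFinD lee_fin /realized_cost.
rewrite mulr_sumr -big_split/= /zero_policy; apply: ler_sum => i _; rewrite hgw.
set m := empirical_mean _ _ _; set u := g i _; set y := x i w.
rewrite -subr_ge0.
(* For one member, the bound minus the cost is a sum of squares. *)
rewrite [leRHS](_ : _ = r * (1 - a) * (1 + a) * u ^+ 2 +
    q * ((1 - a) * ((u - y - m) ^+ 2 + a * u ^+ 2))); last by ring.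
have r0 := ltW hr; have a10 : 0 <= 1 + a by rewrite addr_ge0.
apply: addr_ge0.
  by apply: mulr_ge0 (sqr_ge0 _); apply: mulr_ge0 a10; exact: mulr_ge0.
apply/mulr_ge0/mulr_ge0/addr_ge0 => //; first exact: sqr_ge0.
exact: mulr_ge0 (sqr_ge0 _).
Qed.

Context (x_Lfun2 : forall i, (x i : Omega -> K) \in Lfun P 2%:E).
Context (x_second_moment : forall i,
  ('E_P[(x i : Omega -> K) ^+ 2] = 'E_P[(x 0 : Omega -> K) ^+ 2])%E).

(** Pointwise [sum (x_i + m)^2 + 3 sum (x_i - m)^2 = 4 sum x_i^2] when [m] is
the mean of the [x_i], which bounds the cost of the zero policy uniformly in
the size of the team. *)
Lemma team_cost_zero_le N : (0 < N)%N ->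
  (team_cost r q x v (@zero_policy N) <=
   (4%:R * q)%:E * 'E_P[(x 0 : Omega -> K) ^+ 2])%E.
Proof.
move=> N0; have Nn0 : N%:R != 0 :> K by rewrite pnatr_eq0 -lt0n.
rewrite /team_cost -/(realized_cost (@zero_policy N)).
have mR0 := measurable_realized_cost (@policies_zero N).
have msq i : measurable_fun setT (fun w => (((x i : Omega -> K) ^+ 2) w)%:E).
  have mx2 : measurable_fun setT (fun w => x i w ^+ 2).
    exact: measurable_funX.
  exact/measurable_EFinP.
have step : ('E_P[realized_cost (@zero_policy N)] <=
    (4%:R * q)%:E * \sum_(i < N) 'E_P[(x i : Omega -> K) ^+ 2])%E.
  rewrite unlock -ge0_integral_sum//; [|by move=> i w _; rewrite lee_fin sqr_ge0].
  rewrite -ge0_integralZl//; last 3 first.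
  - exact: emeasurable_sum.
  - by move=> w _; apply: sume_ge0 => i _; rewrite lee_fin sqr_ge0.
  - by rewrite lee_fin mulr_ge0.
  apply: ge0_le_integral => //.
  - by move=> w _; rewrite lee_fin realized_cost_ge0.
  - exact/measurable_EFinP.
  - by apply: measurable_funeM; exact: emeasurable_sum.
  move=> w _; rewrite sumEFin -EFinM lee_fin /realized_cost /zero_policy.
  set m := empirical_mean x N w.
  have sumx : \sum_(i < N) x i w = N%:R * m.
    by rewrite /m /empirical_mean mulVKf.
  have -> : 4%:R * q * (\sum_(i < N) ((x i : Omega -> K) ^+ 2) w) =
      \sum_(i < N) (r * 0 ^+ 2 + q * (0 - x i w - m) ^+ 2) +
      \sum_(i < N) (3%:R * q * (x i w - m) ^+ 2).
    rewrite -big_split/= mulr_sumr.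
    apply/eqP; rewrite -subr_eq0 -sumrB; apply/eqP.
    rewrite (eq_bigr (fun i : 'I_N => 4%:R * q * m * (x i w - m)))
      => [|i _]; last first.
      by rewrite -[((x i : Omega -> K) ^+ 2) w]/(x i w ^+ 2); ring.
    rewrite -mulr_sumr sumrB sumx sumr_const card_ord -[m *+ N]mulr_natl.
    by rewrite subrr mulr0.
  rewrite lerDl sumr_ge0// => i _.
  by rewrite mulr_ge0 ?sqr_ge0 ?mulr_ge0.
apply: (@le_trans _ _ ((N%:R^-1)%:E *
    ((4%:R * q)%:E * \sum_(i < N) 'E_P[(x i : Omega -> K) ^+ 2]))%E).
  by rewrite lee_wpmul2l// lee_fin.
under eq_bigr do rewrite x_second_moment.
have /fineK <- := second_moment_fin_num (x_Lfun2 0%N).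
rewrite sumEFin -!EFinM lee_fin sumr_const card_ord -[fine _ *+ _]mulr_natl.
by rewrite [4 * q * _]mulrCA mulKf.
Qed.

(** * Optimal policies of finite teams *)

Context (x_mean : forall i, ('E_P[x i] = 0)%E).
Context (x_indep : forall k i, k != i -> independent P (x k) (v i)).

(** The zero policy has finite cost, so a fortiori an optimal one. *)
Lemma minimizer_cost_Lfun1 N (g : 'I_N -> K -> K) : (0 < N)%N ->
  optimal N g -> realized_cost g \in Lfun P 1.
Proof.
move=> N0 gmin; have mg := gmin.1.
have mR := measurable_realized_cost mg.
have fin : ('E_P[realized_cost g] < +oo)%E.
  rewrite ltNge leye_eq; apply/eqP => Eg.
  have := minimizes_le N0 gmin (@policies_zero N); rewrite Eg leye_eq => /eqP E0.
  have := team_cost_zero_le N0.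
  rewrite /team_cost -/(realized_cost (@zero_policy N)) E0.
  rewrite gt0_muley ?lte_fin ?invr_gt0 ?ltr0n// leye_eq => /eqP.
  have /fineK <- := second_moment_fin_num (x_Lfun2 0%N).
  by rewrite -EFinM.
apply/Lfun1_integrable; apply/integrableP; split; first exact/measurable_EFinP.
move: fin; rewrite unlock; congr (_ < _)%E; apply: eq_integral => w _.
by rewrite /= ger0_norm// realized_cost_ge0.
Qed.

(** Since [r] is positive, the cost dominates the square of each action. *)
Lemma minimizer_Lfun2 N (g : 'I_N -> K -> K) (i : 'I_N) : (0 < N)%N ->
  optimal N g -> g i \o v i \in Lfun P 2%:E.
Proof.
move=> N0 gmin; have mg := gmin.1.
have mR := measurable_realized_cost mg.
have mgv : measurable_fun setT (g i \o v i) by exact: (measurableT_comp (mg i)).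
apply: Lfun2P => //.
have cost1 := minimizer_cost_Lfun1 N0 gmin.
have scaled1 : r^-1 \o* realized_cost g \in Lfun P 1 by exact: Lfun_scale.
apply: (@le_lt_trans _ _ ('E_P[(r^-1 \o* realized_cost g)%R])%E); last first.
  rewrite -ge0_fin_numE ?expectation_fin_num// expectation_ge0// => w /=.
  by rewrite mulr_ge0 ?realized_cost_ge0// invr_ge0 ltW.
apply: expectation_le => //.
- have : measurable_fun setT (fun w => (g i \o v i) w ^+ 2).
    exact: measurable_funX.
  exact.
- exact: Lfun_measurable scaled1.
- by move=> w; rewrite -[_ w]/((g i \o v i) w ^+ 2) sqr_ge0.
- by move=> w /=; rewrite mulr_ge0 ?realized_cost_ge0// invr_ge0 ltW.
apply: aeW => w; rewrite -[leLHS]/((g i \o v i) w ^+ 2) /= ler_pdivlMr// mulrC.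
rewrite /realized_cost (bigD1 i)//= -addrA lerDl addr_ge0 //.
  by rewrite mulr_ge0 ?sqr_ge0.
by apply: sumr_ge0 => j _; rewrite addr_ge0// mulr_ge0 ?sqr_ge0// ltW.
Qed.

Lemma empirical_mean_Lfun2 N : empirical_mean x N \in Lfun P 2%:E.
Proof.
rewrite (_ : empirical_mean x N =
    N%:R^-1 \o* (\sum_(k < N) (x k : Omega -> K))); last first.
  by apply/funext => w /=; rewrite /empirical_mean fct_sumE mulrC.
apply: Lfun2_scale; elim/big_ind: _ => [|X Y|k _];
  [|exact: Lfun2D|exact: x_Lfun2].
by rewrite rpred0 ?lee1n.
Qed.

(** First-order condition: perturbing the policy of [i] by [t phi] changes the
expected cost by a quadratic polynomial in [t] whose linear coefficient is twice
the expectation below; it is nonnegative for all [t], so this coefficient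
vanishes. *)
Lemma minimizer_orthogonal N (g : 'I_N -> K -> K) (i : 'I_N) (phi : K -> K) :
    (0 < N)%N -> optimal N g ->
    measurable_fun setT phi -> phi \o v i \in Lfun P 2%:E ->
  ('E_P[fun w => (((r + q) * g i (v i w) -
    q * (x i w + empirical_mean x N w)) * phi (v i w))%R] = 0)%E.
Proof.
move=> N0 gmin mphi phi2; have mg := gmin.1.
have cost1 := minimizer_cost_Lfun1 N0 gmin.
have g2 := minimizer_Lfun2 i N0 gmin.
pose A : Omega -> K := ((r + q) \o* (g i \o v i) -
  q \o* ((x i : Omega -> K) + empirical_mean x N)) * (phi \o v i).
pose B : Omega -> K := (r + q) \o* ((phi \o v i) * (phi \o v i)).
have A1 : A \in Lfun P 1.
  apply: Lfun2_mul_Lfun1 => //; apply: Lfun2B; apply: Lfun2_scale => //.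
  by apply: Lfun2D => //; exact: empirical_mean_Lfun2.
have B1 : B \in Lfun P 1 by apply: Lfun_scale => //; exact: Lfun2_mul_Lfun1.
rewrite (_ : (fun w => _) = A); last first.
  by apply/funext => w; rewrite /A /= !fctE/=; ring.
have /fineK EA := expectation_fin_num A1.
have /fineK EB := expectation_fin_num B1.
have /fineK EC := expectation_fin_num cost1.
have B0 : 0 <= fine 'E_P[B].
  rewrite fine_ge0// expectation_ge0// => w; rewrite /B /=.
  by rewrite mulr_ge0 ?addr_ge0 ?(ltW hr)// -expr2 sqr_ge0.
suff : 2 * fine 'E_P[A] = 0.
  by move/eqP; rewrite mulf_eq0 pnatr_eq0/= => /eqP EA0; rewrite -EA EA0.
apply: (quadratic_ge0_linear0 B0) => t.
pose h (j : 'I_N) (y : K) := if j == i then g j y + t * phi y else g j y.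
have mh : policies h.
  move=> j; rewrite /h; case: eqP => _; last exact: mg.
  by apply: measurable_funD; [exact: mg|exact: measurable_funM].
have costh : realized_cost h =
    realized_cost g + ((2 * t) \o* A + (t ^+ 2) \o* B).
  apply/funext => w; rewrite /realized_cost /A /B !fctE /=.
  rewrite (bigD1 i)//= [in RHS](bigD1 i)//=.
  rewrite (eq_bigr (fun j => r * g j (v j w) ^+ 2 +
    q * (g j (v j w) - x j w - empirical_mean x N w) ^+ 2)).
    by rewrite /h eqxx; ring.
  by move=> j ji; rewrite /h (negbTE ji).
have tA1 : (2 * t) \o* A \in Lfun P 1 by exact: Lfun_scale.
have tB1 : (t ^+ 2) \o* B \in Lfun P 1 by exact: Lfun_scale.
have := minimizes_le N0 gmin mh.
rewrite costh (expectationD cost1) ?rpredD// (expectationD tA1 tB1).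
rewrite (expectationZl _ A1) (expectationZl _ B1) -EA -EB -EC.
rewrite -!EFinM -!EFinD lee_fin lerDl.
by rewrite -mulrA mulrCA.
Qed.

(** Of the sum that defines the empirical mean, only the term [x i] correlates
with [phi (v i)]. *)
Lemma minimizer_normal_equation N (g : 'I_N -> K -> K) (i : 'I_N)
    (phi : K -> K) : (0 < N)%N -> optimal N g ->
    measurable_fun setT phi -> phi \o v i \in Lfun P 2%:E ->
  (r + q) * fine 'E_P[(g i \o v i) * (phi \o v i)] =
  q * (1 + N%:R^-1) * fine 'E_P[(x i : Omega -> K) * (phi \o v i)].
Proof.
move=> N0 gmin mphi phi2; have g2 := minimizer_Lfun2 i N0 gmin.
have prod1 (X : Omega -> K) :
    X \in Lfun P 2%:E -> X * (phi \o v i) \in Lfun P 1.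
  by move=> X2; exact: Lfun2_mul_Lfun1.
have EF (X : Omega -> K) :
    X \in Lfun P 1 -> ('E_P[X] = (fine 'E_P[X])%:E)%E.
  by move=> X1; rewrite fineK// expectation_fin_num.
have := minimizer_orthogonal N0 gmin mphi phi2.
pose xphi (k : 'I_N) : Omega -> K := (x k : Omega -> K) * (phi \o v i).
rewrite (_ : (fun w => _) = (r + q) \o* ((g i \o v i) * (phi \o v i)) -
    q \o* ((x i : Omega -> K) * (phi \o v i)) -
    (q * N%:R^-1) \o* (\sum_(X <- [seq xphi k | k : 'I_N]) X)); last first.
  apply/funext => w; rewrite big_map /xphi -mulr_suml !fctE/= fct_sumE /empirical_mean.
  by rewrite big_enum/=; ring.
have sum1 : \sum_(X <- [seq xphi k | k : 'I_N]) X \in Lfun P 1.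
  by rewrite big_map rpred_sum// => k _; exact: prod1.
have gphi1 := prod1 _ g2; have xphi1 := prod1 _ (x_Lfun2 i).
have s1 (X : Omega -> K) a : X \in Lfun P 1 -> a \o* X \in Lfun P 1.
  by move=> ?; exact: Lfun_scale.
rewrite expectationB ?rpredB ?s1// expectationB ?s1// !expectationZl//.
rewrite expectation_sum; last by move=> X /mapP[k _ ->]; exact: prod1.
rewrite big_map big_enum (bigD1 i)//= big1 ?adde0; last first.
  move=> k ki; apply: expectation_mul_independent => //.
  by apply: independent_comp => //; exact: x_indep.
rewrite (EF _ gphi1) (EF _ xphi1) -!EFinM -!EFinB => -[] /eqP.
by rewrite -addrA -opprD subr_eq0 => /eqP ->; ring.
Qed.

(** By the normal equations the difference [D] of the two sides is orthogonal to
every square integrable function of the observation; it is one itself. *)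
Lemma minimizers_proportional N M (g : 'I_N -> K -> K) (h : 'I_M -> K -> K)
    (i : 'I_N) (j : 'I_M) : (0 < N)%N -> (0 < M)%N -> i = j :> nat ->
    optimal N g ->
    optimal M h ->
  {ae P, forall w, (1 + M%:R^-1) * g i (v i w) = (1 + N%:R^-1) * h j (v i w)}.
Proof.
move=> N0 M0 ij gmin hmin.
pose D y := (1 + M%:R^-1) * g i y - (1 + N%:R^-1) * h j y.
have mD : measurable_fun setT D.
  by apply: measurable_funB; apply: measurable_funM => //;
    [exact: gmin.1|exact: hmin.1].
have g2 := minimizer_Lfun2 i N0 gmin; have h2 := minimizer_Lfun2 j M0 hmin.
have D2 : D \o v i \in Lfun P 2%:E.
  rewrite (_ : D \o v i = (1 + M%:R^-1) \o* (g i \o v i) -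
      (1 + N%:R^-1) \o* (h j \o v j)).
    by apply: Lfun2B; exact: Lfun2_scale.
  by apply/funext => w; rewrite /D !fctE/= ij; ring.
have Eg := minimizer_normal_equation N0 gmin mD D2.
have D2j : D \o v j \in Lfun P 2%:E by rewrite -ij.
have Eh := minimizer_normal_equation M0 hmin mD D2j.
have gD1 := Lfun2_mul_Lfun1 g2 D2; have hD1 := Lfun2_mul_Lfun1 h2 D2.
have DD1 := Lfun2_mul_Lfun1 D2 D2.
have EDD : ('E_P[(D \o v i) \* (D \o v i)] = 0)%E.
  rewrite (_ : (D \o v i) \* (D \o v i) =
     (1 + M%:R^-1) \o* ((g i \o v i) \* (D \o v i)) \-
     (1 + N%:R^-1) \o* ((h j \o v j) \* (D \o v i))); last first.
    by apply/funext => w /=; rewrite {1}/D ij; ring.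
  rewrite expectationB ?Lfun_scale// !expectationZl//.
  rewrite -(fineK (expectation_fin_num gD1)) -(fineK (expectation_fin_num hD1)).
  rewrite -!EFinM -EFinB; congr EFin.
  move: Eg Eh; rewrite -ij; set e := fine 'E_P[(x i : Omega -> K) * _] => Eg Eh.
  have rq0 : r + q != 0 by rewrite gt_eqF// ltr_wpDr.
  apply: (mulfI rq0); rewrite mulr0 mulrBr !(mulrCA (r + q)).
  transitivity ((1 + M%:R^-1) * (q * (1 + N%:R^-1) * e) -
      (1 + N%:R^-1) * (q * (1 + M%:R^-1) * e)).
    by rewrite -Eg -Eh.
  by ring.
have : ae_eq P setT (EFin \o ((D \o v i) \* (D \o v i))) (cst 0%E).
  have mDD : measurable_fun setT (EFin \o ((D \o v i) \* (D \o v i))).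
    exact/measurable_EFinP/(Lfun_measurable DD1).
  apply/(ae_eq_integral_abs _ measurableT mDD).
  move: EDD; rewrite unlock => EDD; rewrite -[RHS]EDD; apply: eq_integral => w _.
  by rewrite /= ger0_norm// -expr2 sqr_ge0.
apply: filterS => w /(_ I)/= [] /eqP; rewrite mulf_eq0 orbb /D subr_eq0 => /eqP.
exact.
Qed.

(** * The limit policy and its optimality *)

Context (gstar : forall N : nat, 'I_N -> K -> K).
Context (gstar_min : forall N, (0 < N)%N ->
  optimal N (@gstar N)).

(** The team of [i.+1] members is the smallest one that contains [i]; any other
team would give the same policy up to a null set. *)
Definition limit_policy i (y : K) : K :=
  (1 + i.+1%:R^-1)^-1 * policy_of (@gstar) i 0 y.

Lemma policies_limit_policy : policies limit_policy.
Proof.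
move=> i; apply: measurable_funM => //; apply: (gstar_min _).1.
by rewrite addSn.
Qed.

Lemma size_factor_gt0 n : 0 < 1 + n%:R^-1 :> K.
Proof. by rewrite ltr_pwDl// invr_ge0. Qed.

Lemma policy_of_limit_policy i : {ae P, forall w, forall n,
  policy_of (@gstar) i n (v i w) =
  (1 + (i.+1 + n)%:R^-1) * limit_policy i (v i w)}.
Proof.
apply: ae_foralln => n.
have := @minimizers_proportional (i.+1 + n) (i.+1 + 0) (@gstar _) (@gstar _)
  (lshift n ord_max) (lshift 0 ord_max) (ltn0Sn _) (ltn0Sn _) erefl
  (gstar_min (ltn0Sn _)) (gstar_min (ltn0Sn _)).
apply: filterS => w /= E.
rewrite /limit_policy mulrCA -[policy_of (@gstar) i 0 _]/(gstar _ _) -E addn0.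
by rewrite mulKf// gt_eqF// size_factor_gt0.
Qed.

Lemma cvg_size_factor i : (1 + (i.+1 + n)%:R^-1 : K) @[n --> \oo] --> (1 : K).
Proof.
have shifted : harmonic (i + n) @[n --> \oo] --> (0 : K).
  exact: (cvg_comp _ _ (@cvg_addnl i) (@cvg_harmonic K)).
have := cvgD (cvg_cst (1 : K)) shifted.
by rewrite addr0; apply.
Qed.

Lemma as_limit_policyP : as_limit_policy v (@gstar) limit_policy.
Proof.
move=> i; apply: filterS (policy_of_limit_policy i) => w E.
under eq_fun do rewrite E.
have := cvgM (cvg_size_factor i) (cvg_cst (limit_policy i (v i w))).
by rewrite mul1r; apply.
Qed.

Lemma as_limit_policy_unique (g h : nat -> K -> K) i :
  as_limit_policy v (@gstar) g -> as_limit_policy v (@gstar) h ->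
  {ae P, forall w, g i (v i w) = h i (v i w)}.
Proof.
by move=> gl hl; apply: filterS2 (gl i) (hl i) => w; exact: cvg_unique.
Qed.

(** Any almost sure limit agrees with [limit_policy] along the observations, and
is thus an optimal policy of each finite team shrunk by [1 / (1 + 1/N)]; the
price of shrinking is [O(1/N)]. *)
Lemma as_limit_policy_optimal (ginf : nat -> K -> K) : policies ginf ->
  as_limit_policy v (@gstar) ginf -> minimizes (limit_cost r q x v) ginf.
Proof.
move=> minf linf; split => //; apply/eqP; rewrite eq_le; apply/andP; split; last first.
  by apply: ereal_inf_lbound; exists ginf.
apply: le_ereal_inf_tmp => _ [h mh <-].
pose C := 4%:R * q * fine 'E_P[(x 0%N : Omega -> K) ^+ 2].
have scale_inv N : (0 < N)%N -> 1 - (1 + N%:R^-1)^-1 = N.+1%:R^-1 :> K.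
  move=> N0; rewrite -natr1; have Np : 0 < N%:R :> K by rewrite ltr0n.
  by field; rewrite !gt_eqF// ?addr_gt0//.
apply: (@le_limn_esup_vanishing _ _ _ (fun N => N.+1%:R^-1 * C)); last first.
  have := cvgM (@cvg_harmonic K) (cvg_cst C).
  by rewrite mul0r; apply.
(* The empty team has cost zero, because its normalization 0^-1 is 0. *)
case=> [|N].
  rewrite /team_cost invr0 !mul0e add0e lee_fin mulr_ge0// mulr_ge0 ?mulr_ge0//.
  by rewrite fine_ge0// expectation_ge0// => w; exact: sqr_ge0.
have N0 : (0 < N.+1)%N by [].
apply: (@le_trans _ _ (team_cost r q x v (@gstar N.+1) +
    (1 - (1 + N.+1%:R^-1)^-1)%:E * team_cost r q x v (@zero_policy N.+1))%E).
  apply: team_cost_shrink => //.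
  - rewrite invr_ge0 ltW ?size_factor_gt0//= invf_le1 ?size_factor_gt0//.
    by rewrite lerDl invr_ge0.
  - exact: (gstar_min N0).1.
  move=> i; have := as_limit_policy_unique i linf as_limit_policyP.
  apply: filterS2 (policy_of_limit_policy i) => w E ->.
  by rewrite (policy_of_ord (@gstar)) E subnKC// mulKf// gt_eqF// size_factor_gt0.
apply: leeD.
  by rewrite le_team_cost//; apply: minimizes_le => //; exact: gstar_min.
rewrite scale_inv// EFinM lee_wpmul2l ?lee_fin ?invr_ge0//.
rewrite /C EFinM fineK; first exact: team_cost_zero_le.
exact: second_moment_fin_num.
Qed.

End Team.

Theorem theorem13 (d : measure_display) (Omega : measurableType d)
    (K : realType) (P : probability Omega K)
    (x z v : nat -> {RV P >-> K}) (r q : K)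
    (gstar : forall N : nat, 'I_N -> K -> K)
    (hx : iid_zero_mean_gaussian x)
    (hz : iid_zero_mean_gaussian z)
    (hxz : independent_families z x)
    (hv : forall i w, v i w = x i w + z i w)
    (hr : 0 < r) (hq : 0 <= q)
    (hopt : forall N : nat, (0 < N)%N ->
      minimizes (@team_cost d Omega K P r q x v N) (gstar N)) :
  (exists ginf : nat -> K -> K,
      policies ginf /\ as_limit_policy v gstar ginf) /\
  (forall ginf : nat -> K -> K,
      policies ginf -> as_limit_policy v gstar ginf ->
      minimizes (limit_cost r q x v) ginf).
Proof.
have [ix idx gx] := hx.
have x2 i := zero_mean_gaussian_Lfun2 (gx i).
have x0 i := zero_mean_gaussian_mean (gx i).
have xid i := identically_distributed_second_moment i 0 idx.
have xv k i := @independent_observation _ _ _ _ _ _ _ k i ix hxz hv.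
split; last by move=> ginf; exact: as_limit_policy_optimal.
exists (limit_policy gstar); split; first exact: (policies_limit_policy hopt).
exact: (as_limit_policyP hr hq x2 xid x0 xv hopt).
Qed.
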